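(* Let $L$ be a first-order language. (i) For every $L$-structure $\mathbb A$ and every $a\in\mathbb A$, we have $(\mathbb A,\mathbb A)\models a\approx a$ (reflexivity in a single structure). (ii) For every $L$-structure $\mathbb A$ and all $a,b\in\mathbb A$, if $(\mathbb A,\mathbb A)\models a\approx b$ then $(\mathbb A,\mathbb A)\models b\approx a$ (symmetry in a single structure). (iii) Similarity in a single structure is in general not transitive: there exist a first-order language $L$, an $L$-structure $\mathbb A$ and elements $a,b,c\in\mathbb A$ such that $(\mathbb A,\mathbb A)\models a\approx b$ and $(\mathbb A,\mathbb A)\models b\approx c$ but not $(\mathbb A,\mathbb A)\models a\approx c$. (iv) In a pair of structures reflexivity may fail: there exist a first-order language $L$, $L$-structures $\mathbb A,\mathbb B$ and an element $a$ belonging to the universes of both $\mathbb A$ and $\mathbb B$ such that $(\mathbb A,\mathbb B)\not\models a\approx a$.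
   Context: Fix a first-order language $L$. Universes of different $L$-structures are arbitrary sets and may share elements. An $L$-formula is called conjunctive if it contains no disjunctions and negation occurs only directly in front of atomic formulas. For an $L$-structure $\mathbb A$ and $a\in\mathbb A$, the conjunctive type of $a$ is $c\text-Type_\mathbb A(a):=\{\varphi(y)\mid \varphi \text{ a conjunctive } L\text{-formula with one free variable } y,\ \mathbb A\models\varphi(a)\}$. For $L$-structures $\mathbb A,\mathbb B$ and $a\in\mathbb A$, $b\in\mathbb B$, put $T(a,b):=c\text-Type_\mathbb A(a)\cap c\text-Type_\mathbb B(b)$. Define $(\mathbb A,\mathbb B)\models a\lesssim b$ iff $T(a,b)$ is $\subseteq$-maximal with respect to $b$ except for $a$ in case $a\in\mathbb B$, i.e. there is no $b'\in\mathbb B$ with $b'\neq a$ such that $T(a,b)\subsetneq T(a,b')$. Define $(\mathbb A,\mathbb B)\models a\approx b$ iff $(\mathbb A,\mathbb B)\models a\lesssim b$ and $(\mathbb B,\mathbb A)\models b\lesssim a$; in this case $a$ and $b$ are called similar in $(\mathbb A,\mathbb B)$. *)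

(* Defs.v *)
From mathcomp Require Import all_boot.
From mathcomp Require Import boolp classical_sets.

Set Implicit Arguments.
Unset Strict Implicit.
Unset Printing Implicit Defensive.

Local Open Scope classical_set_scope.

(* Constants are function symbols of arity 0. *)
Record language := Language {
  fsym : Type;
  farity : fsym -> nat;
  rsym : Type;
  rarity : rsym -> nat }.

Inductive term (L : language) : Type :=
| TVar of nat
| TApp (f : fsym L) of ('I_(farity f) -> term L).

Arguments TVar {L}.

(* Equality is a logical symbol; implication and equivalence are the usual
   abbreviations and hence contain disjunctions. *)
Inductive formula (L : language) : Type :=
| FEq of term L & term L
| FRel (r : rsym L) of ('I_(rarity r) -> term L)
| FNot of formula L
| FAnd of formula L & formula L
| FOr of formula L & formula L
| FAll of nat & formula L
| FEx of nat & formula L.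

Section Syntax.
Variable L : language.

Fixpoint tvars (t : term L) : set nat :=
  match t with
  | TVar n => [set n]
  | TApp _ ts => [set n | exists i, tvars (ts i) n]
  end.

Fixpoint fvars (p : formula L) : set nat :=
  match p with
  | FEq s t => tvars s `|` tvars t
  | FRel _ ts => [set n | exists i, tvars (ts i) n]
  | FNot q => fvars q
  | FAnd q1 q2 | FOr q1 q2 => fvars q1 `|` fvars q2
  | FAll x q | FEx x q => fvars q `\` [set x]
  end.

Definition atomic (p : formula L) : bool :=
  match p with FEq _ _ | FRel _ _ => true | _ => false end.

Fixpoint conjunctive (p : formula L) : bool :=
  match p with
  | FEq _ _ | FRel _ _ => true
  | FNot q => atomic q
  | FAnd q1 q2 => conjunctive q1 && conjunctive q2
  | FOr _ _ => false
  | FAll _ q | FEx _ q => conjunctive q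
  end.

End Syntax.

(* The universe is a subset of an ambient type [U], so that two structures
   over the same [U] can share elements.  Symbols are interpreted on the
   subtype [universe] only. *)
Record structure (L : language) (U : Type) := Structure {
  universe :> set U;
  finterp : forall f : fsym L, ('I_(farity f) -> universe) -> universe;
  rinterp : forall r : rsym L, ('I_(rarity r) -> universe) -> Prop }.

Section Semantics.
Variables (L : language) (U : Type) (A : structure L U).

Fixpoint teval (v : nat -> A) (t : term L) : A :=
  match t with
  | TVar n => v n
  | TApp f ts => finterp (fun i => teval v (ts i))
  end.

Definition update (v : nat -> A) (x : nat) (a : A) : nat -> A :=
  fun n => if n == x then a else v n.

Fixpoint sat (v : nat -> A) (p : formula L) : Prop :=
  match p with
  | FEq s t => teval v s = teval v t
  | FRel r ts => rinterp (fun i => teval v (ts i))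
  | FNot q => ~ sat v q
  | FAnd q1 q2 => sat v q1 /\ sat v q2
  | FOr q1 q2 => sat v q1 \/ sat v q2
  | FAll x q => forall a : A, sat (update v x a) q
  | FEx x q => exists a : A, sat (update v x a) q
  end.

(* The distinguished free variable y is the variable 0; the values given to
   the other variables are irrelevant. *)
Definition ctype (a : A) : set (formula L) :=
  [set p | [/\ conjunctive p, fvars p = [set 0] & sat (fun=> a) p]].

End Semantics.

Section Similarity.
Variables (L : language) (U : Type).

Definition common_type (A B : structure L U) (a : A) (b : B) :
    set (formula L) :=
  ctype a `&` ctype b.

Definition lesssim (A B : structure L U) (a : A) (b : B) : Prop :=
  ~ exists b' : B,
      \val b' <> \val a :> U /\ common_type a b `<` common_type a b'.

Definition similar (A B : structure L U) (a : A) (b : B) : Prop :=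
  lesssim a b /\ lesssim b a.

End Similarity.

Arguments lesssim {L U} A B a b.
Arguments similar {L U} A B a b.

(* Main.v *)
(** A surjective map [h : A -> B -> C] that preserves the symbols, the
    complements of the relations and inequality preserves every conjunctive
    formula, as surjective polymorphisms do for quantified conjunctive
    formulas. Hence [T(a, b)] is contained in the type of [h a b].

    For (iii), take the natural numbers with P = {0, 1} and Q = {1, 2}. The
    formulas P(y) and Q(y) witness 0 ~ 1 and 1 ~ 2, while a map [h] with
    [h 0 2 = 3] shows that T(0, 2) is contained in T(0, 3), properly because of
    the formula ~ Q(y).
    For (iv), take the booleans with the predicate {true} in A and {false} in B:
    negation is an isomorphism from A to B, so the B-element false has the type
    of the A-element true. *)

Require Import Defs.
From mathcomp Require Import all_boot.
From mathcomp Require Import boolp classical_sets.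

Set Implicit Arguments.
Unset Strict Implicit.
Unset Printing Implicit Defensive.

Local Open Scope classical_set_scope.

Section Preservation.
Variables (L : language) (U V W : Type).
Variables (A : structure L U) (B : structure L V) (C : structure L W).
Variable h : A -> B -> C.

Record conj_morphism : Prop := ConjMorphism {
  conj_morphism_surj : forall z, exists x y, h x y = z;
  conj_morphism_neq : forall x x' y y',
    x <> x' -> y <> y' -> h x y <> h x' y';
  conj_morphism_fun : forall f xs ys,
    h (finterp (f := f) xs) (finterp ys) = finterp (fun i => h (xs i) (ys i));
  conj_morphism_rel : forall r xs ys,
    rinterp (r := r) xs -> rinterp ys -> rinterp (fun i => h (xs i) (ys i));
  conj_morphism_nrel : forall r xs ys,
    ~ rinterp (r := r) xs -> ~ rinterp ys ->
    ~ rinterp (fun i => h (xs i) (ys i)) }.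

Hypothesis hP : conj_morphism.

Lemma teval_conj_morphism (v : nat -> A) (w : nat -> B) (t : term L) :
  teval (fun n => h (v n) (w n)) t = h (teval v t) (teval w t).
Proof.
elim: t => //= f ts IH; rewrite (conj_morphism_fun hP); congr finterp.
by apply/funext.
Qed.

Lemma update_conj_morphism (v : nat -> A) (w : nat -> B) n x y :
  (fun k => h (update v n x k) (update w n y k)) =
  update (fun k => h (v k) (w k)) n (h x y).
Proof. by apply/funext => k; rewrite /update; case: ifP. Qed.

(** Induction on the formula: surjectivity reaches every value of a universally quantified variable.
    Disjunctions are excluded because the two valuations may satisfy different disjuncts. *)
Lemma sat_conj_morphism (p : formula L) (v : nat -> A) (w : nat -> B) :
  conjunctive p -> sat v p -> sat w p -> sat (fun n => h (v n) (w n)) p.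
Proof.
have tevalE v' w' r (ts : 'I_(rarity r) -> term L) :
    (fun i => teval (fun n => h (v' n) (w' n)) (ts i)) =
    (fun i => h (teval v' (ts i)) (teval w' (ts i))).
  by apply/funext => i; rewrite teval_conj_morphism.
elim: p v w => [s t|r ts|q _|q1 IH1 q2 IH2|//|n q IH|n q IH] v w /=.
- by rewrite !teval_conj_morphism => _ -> ->.
- by rewrite tevalE => _; apply: conj_morphism_rel.
- case: q => //= [s t|r ts] _.
    by rewrite !teval_conj_morphism; apply: conj_morphism_neq.
  by rewrite tevalE; apply: conj_morphism_nrel.
- by move=> /andP[c1 c2] [v1 v2] [w1 w2]; split; [apply: IH1|apply: IH2].
- move=> c vq wq z; have [x [y <-]] := conj_morphism_surj hP z.
  by rewrite -update_conj_morphism; apply: IH.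
- move=> c [x vq] [y wq]; exists (h x y).
  by rewrite -update_conj_morphism; apply: IH.
Qed.

Lemma ctype_conj_morphism (a : A) (b : B) :
  ctype a `&` ctype b `<=` ctype (h a b).
Proof.
move=> p [[cp fp va] [_ _ wb]]; split=> //.
exact: (sat_conj_morphism (v := fun=> a) (w := fun=> b)).
Qed.

End Preservation.

(** T(a, a) is the whole conjunctive type of a, so it contains every T(a, b). *)
Lemma lesssim_refl (L : language) (U : Type) (A : structure L U) (a : A) :
  lesssim A A a a.
Proof. by case=> b [_ [_]]; apply => p [pa _]. Qed.

Definition unary_language (S : Type) : language :=
  @Language void (fun=> 0) S (fun=> 1).

Definition unary_structure (S U : Type) (I : S -> U -> Prop) :
    structure (unary_language S) U :=
  @Structure (unary_language S) U setT
    (fun f => match f : void with end)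
    (fun r xs => I r (val (xs ord0))).

Section Unary.
Variables (S U : Type) (I : S -> U -> Prop).
Let A := unary_structure I.

Definition unary_elt (u : U) : A := exist _ u (mem_set (Logic.I : setT u)).

Lemma val_unary_elt (x : A) : unary_elt (val x) = x.
Proof. exact: val_inj. Qed.

Definition unary_atom (s : S) : formula (unary_language S) :=
  @FRel (unary_language S) s (fun=> TVar 0).

Lemma fvars_unary_atom (s : S) : fvars (unary_atom s) = [set 0].
Proof.
by apply/seteqP; split=> [n [_ //]|n ->]; exists ord0.
Qed.

Lemma ctype_unary_atom (s : S) (x : A) :
  ctype x (unary_atom s) <-> I s (val x).
Proof. by split=> [[]//|Ix]; split=> //; rewrite fvars_unary_atom. Qed.

Lemma ctype_unary_natom (s : S) (x : A) :
  ctype x (FNot (unary_atom s)) <-> ~ I s (val x).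
Proof. by split=> [[]//|Ix]; split=> //; rewrite -(fvars_unary_atom s). Qed.

(** The atom of [s] lies in T(a, b), so an element with a larger common type satisfies it and is a
    or b. The definition rules out a, and b gives no proper inclusion. *)
Lemma lesssim_pair (s : S) (a b : U) :
  (forall u, I s u <-> u = a \/ u = b) ->
  lesssim A A (unary_elt a) (unary_elt b).
Proof.
move=> Is [x [xa [sub nsub]]].
have [_ /ctype_unary_atom/Is[//|xb]] :
    common_type (unary_elt a) x (unary_atom s).
  by apply: sub; split; apply/ctype_unary_atom/Is; [left|right].
by apply: nsub; rewrite -xb val_unary_elt.
Qed.

Lemma similar_pair (s : S) (a b : U) :
  (forall u, I s u <-> u = a \/ u = b) ->
  similar A A (unary_elt a) (unary_elt b).
Proof.
move=> Is; split; first exact: (lesssim_pair (s := s)).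
by apply: (lesssim_pair (s := s)) => u; rewrite Is; split=> -[]; auto.
Qed.

End Unary.

(** The index [true] stands for P and [false] for Q. *)
Definition two_pairs (s : bool) (n : nat) : Prop :=
  if s then n = 0 \/ n = 1 else n = 1 \/ n = 2.

(* The constraints on [h] are: agreement of the arguments on a predicate is
   inherited by the value, and each fibre has a constant first argument. *)
Definition two_pairs_op (m n : nat) : nat :=
  match m, n with
  | 0, (0 | 1) => 0
  | 0, _ => 3
  | 1, _ => 1
  | 2, (1 | 2) => 2
  | 2, _ => 4
  | k.+3, _ => k.+2.+3
  end.

Lemma two_pairs_op_surj k : exists m n, two_pairs_op m n = k.
Proof.
case: k => [|[|[|[|[|k]]]]]; [by exists 0, 0|by exists 1, 0|by exists 2, 2|
  by exists 0, 2|by exists 2, 0|by exists k.+3, 0].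
Qed.

(** First arguments from 3 on are shifted by two, which frees the values 3 and 4 for the first
    arguments 0 and 2. This yields preservation of inequality. *)
Lemma two_pairs_op_injl m m' n n' :
  two_pairs_op m n = two_pairs_op m' n' -> m = m'.
Proof.
by case: m m' n n' => [|[|[|m]]] [|[|[|m']]] [|[|[|n]]] [|[|[|n']]] //= [->].
Qed.

Lemma two_pairs_op_rel s m n :
  two_pairs s m -> two_pairs s n -> two_pairs s (two_pairs_op m n).
Proof.
by case: s m n => -[|[|[|m]]] [|[|[|n]]] /=; intuition congruence.
Qed.

Lemma two_pairs_op_nrel s m n :
  ~ two_pairs s m -> ~ two_pairs s n -> ~ two_pairs s (two_pairs_op m n).
Proof.
by case: s m n => -[|[|[|m]]] [|[|[|n]]] /=; intuition congruence.
Qed.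

Lemma two_pairs_opP : conj_morphism
  (fun x y : unary_structure two_pairs =>
     unary_elt two_pairs (two_pairs_op (val x) (val y))
     : unary_structure two_pairs).
Proof.
split.
- move=> z; have [m [n e]] := two_pairs_op_surj (val z).
  by exists (unary_elt _ m), (unary_elt _ n); rewrite /= e val_unary_elt.
- by move=> x x' y y' xx' _ /(congr1 val)/two_pairs_op_injl/val_inj.
- by case.
- by move=> s xs ys; apply: two_pairs_op_rel.
- by move=> s xs ys; apply: two_pairs_op_nrel.
Qed.

Lemma two_pairs_not_lesssim :
  ~ lesssim (unary_structure two_pairs) (unary_structure two_pairs)
      (unary_elt _ 0) (unary_elt _ 2).
Proof.
apply; exists (unary_elt _ 3); split=> //; split.
  move=> p pT; split; first by case: pT.
  (* Here [two_pairs_op 0 2] reduces to 3. *)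
  exact: (ctype_conj_morphism two_pairs_opP pT).
(* Properness: ~ Q(y) holds at 0 and 3 but fails at 2. *)
move=> /(_ (FNot (unary_atom false)))[].
  by split; apply/ctype_unary_natom => -[].
by move=> _ /ctype_unary_natom; apply; right.
Qed.

Definition point (b : bool) (_ : unit) (c : bool) : Prop := c = b.

(** An isomorphism fits the binary notion as a map that ignores its second argument. *)
Lemma negb_conj_morphism (b : bool) : conj_morphism
  (fun x y : unary_structure (point b) =>
     unary_elt (point (~~ b)) (~~ val x) : unary_structure (point (~~ b))).
Proof.
split.
- move=> z; exists (unary_elt _ (~~ val z)), (unary_elt _ true).
  by rewrite /= negbK val_unary_elt.
- by move=> x x' y y' xx' _ /(congr1 val)/negb_inj/val_inj.
- by case.
- by move=> r xs ys; rewrite /= /point => ->.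
- by move=> r xs ys; rewrite /= /point => n _ /negb_inj.
Qed.

Lemma point_not_lesssim (tA : true \in universe (unary_structure (point true)))
    (tB : true \in universe (unary_structure (point false))) :
  ~ lesssim (unary_structure (point true)) (unary_structure (point false))
      (exist _ true tA) (exist _ true tB).
Proof.
apply; exists (unary_elt _ false); split=> //; split.
  move=> p [pA _]; split=> //.
  exact: (ctype_conj_morphism (negb_conj_morphism true) (conj pA pA)).
(* Properness: the atom holds at true in the first structure and at false in the second, but not at
   true in the second. *)
move=> /(_ (unary_atom tt))[].
  by split; apply/ctype_unary_atom.
by move=> _ /ctype_unary_atom.
Qed.

Theorem theorem1 :
  (forall (L : language) (U : Type) (A : structure L U) (a : A),
     similar A A a a) /\
  (forall (L : language) (U : Type) (A : structure L U) (a b : A),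
     similar A A a b -> similar A A b a) /\
  (exists (L : language) (U : Type) (A : structure L U) (a b c : A),
     similar A A a b /\ similar A A b c /\ ~ similar A A a c) /\
  (exists (L : language) (U : Type) (A B : structure L U)
          (a : U) (aA : a \in universe A) (aB : a \in universe B),
     ~ similar A B (exist _ a aA) (exist _ a aB)).
Proof.
split; first by move=> L U A a; split; exact: lesssim_refl.
split; first by move=> L U A a b [].
split.
  exists (unary_language bool), nat, (unary_structure two_pairs).
  exists (unary_elt _ 0), (unary_elt _ 1), (unary_elt _ 2).
  split; first exact: (similar_pair (s := true)).
  split; first exact: (similar_pair (s := false)).
  by case=> /two_pairs_not_lesssim.
exists (unary_language unit), bool, (unary_structure (point true)),
  (unary_structure (point false)), true, (mem_set Logic.I), (mem_set Logic.I).
by case=> /point_not_lesssim.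
Qed.
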